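(* For every integer $n\ge 2$ there is a countable orderable group $G$ such that its space of orders $\mathbb X(G)$ is countable and has Cantor-Bendixson rank $n$.
   Context: A group $G$ is orderable if it admits a strict total order $<$ that is bi-invariant: $a<b$ implies $ca<cb$ and $ac<bc$ for all $a,b,c\in G$. Equivalently, $G$ admits a positive cone, i.e. a subset $P\subseteq G$ with $G=P\sqcup P^{-1}\sqcup\{1\}$, $P\cdot P\subseteq P$, and $gPg^{-1}\subseteq P$ for all $g\in G$ (an order $<$ corresponds to the cone $\{g\in G: 1<g\}$). The space of orders $\mathbb X(G)$ is the set of all positive cones of $G$, with the subspace topology from $2^G$ (product topology, $2=\{0,1\}$ discrete). For a topological space $X$, the derivative $X'$ is the set of non-isolated points of $X$; put $X^{(0)}=X$, $X^{(\alpha+1)}=(X^{(\alpha)})'$, and $X^{(\alpha)}=\bigcap_{\gamma<\alpha}X^{(\gamma)}$ for limit ordinals $\alpha$ (each $X^{(\alpha)}$ with the subspace topology). The Cantor-Bendixson rank of $X$ is the least ordinal $\alpha$ with $X^{(\alpha)}=X^{(\alpha+1)}$. *)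

(* Defs.v *)
From mathcomp Require Import all_boot.
From mathcomp Require Import all_classical topology.

Set Implicit Arguments.
Unset Strict Implicit.
Unset Printing Implicit Defensive.

Local Open Scope classical_set_scope.
Local Open Scope group_scope.

Section Orders.
Variable G : groupType.

Definition biinvariant_order (lt : G -> G -> Prop) : Prop :=
  [/\ forall a, ~ lt a a,
      forall a b c, lt a b -> lt b c -> lt a c,
      forall a b, [\/ lt a b, a = b | lt b a]
    & forall a b c, lt a b -> lt (c * a) (c * b) /\ lt (a * c) (b * c)].

Definition orderable : Prop :=
  exists lt : G -> G -> Prop, biinvariant_order lt.

Definition inverse_set (P : set G) : set G := [set g^-1 | g in P].

Definition positive_cone (P : set G) : Prop :=
  [/\ [/\ P `|` inverse_set P `|` [set 1%g] = [set: G],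
          [disjoint P & inverse_set P],
          [disjoint P & [set 1%g]]
        & [disjoint inverse_set P & [set 1%g]]],
      forall g h, P g -> P h -> P (g * h)
    & forall g h, P h -> P (g * h * g^-1)].

(* 2^G is [{ptws G -> bool}]: [bool] is discrete, and pointwise convergence is
   the product topology. Subsets of G are identified with their indicators. *)
Definition space_of_orders : set {ptws G -> bool} :=
  [set f | positive_cone [set g | f g]].

End Orders.
Arguments orderable G : clear implicits.
Arguments space_of_orders G : clear implicits.

Section CantorBendixson.
Variable T : topologicalType.

(* Subspaces of T are represented by their underlying sets: [isolated A] is the
   set of isolated points of A for the topology induced by T. *)
Definition derivative (A : set T) : set T := A `\` isolated A.

Definition iter_derivative (k : nat) (A : set T) : set T := iter k derivative A.

(* Every ordinal below a natural number is a natural number, so to say that the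
   rank is the finite ordinal n only involves the derivatives of finite order;
   the intersections at limit stages never occur. *)
Definition has_CB_rank (A : set T) (n : nat) : Prop :=
  iter_derivative n A = iter_derivative n.+1 A /\
  forall k, (k < n)%N -> iter_derivative k A <> iter_derivative k.+1 A.

End CantorBendixson.

(* Main.v *)
Require Import Defs.
From mathcomp Require Import all_boot.
From mathcomp Require Import all_classical topology.
From HB Require Import structures.
From mathcomp Require Import all_order all_algebra.
From mathcomp Require Import finmap zify ring lra.

Set Implicit Arguments.
Unset Strict Implicit.
Unset Printing Implicit Defensive.

Import Order.TTheory GRing.Theory Num.Theory.

(** The group is a tower of abelian pieces, A : (Z^2 : Z).  The top Z is
    generated by a shift s, which acts on Z^2 by the hyperbolic matrix
    M = (1 1; 1 2).  The bottom A is the rational vector space with basis e_p,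
    p = (j, i) ranging over n copies of Z; the shift sends e_(j,i) to
    e_(j,i+1), and d in Z^2 multiplies e_(j,i) by the positive rational
    (2^x 3^y)^(j+1), where (x, y) = M^(-i) d.

    Every bi-invariant order is lexicographic along this tower: A is
    infinitesimal next to Z^2 because (a, d) is conjugate to d when d <> 0
    [cone_plane_level], and Z^2 next to s because 1 - M is invertible
    [cone_shift_level].  The M-invariant orders on Z^2 are determined by the
    signs of two vectors [plane_cone_eq].  The weights by which Z^2 acts on
    distinct e_p, e_q have unbounded ratios, so one of |e_p|, |e_q| is
    infinitely larger than the other [below_dominates]; the order on A is
    therefore determined by the signs of the e_p and by the linear order
    between the |e_p| [vec_cone_eq].  Up to finitely many bits, an order on the
    group is thus a linear order on n copies of Z that is invariant under the
    simultaneous shift.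

    In such a linear order two copies of Z either interleave, with a relative
    offset that is an integer, or one lies entirely below the other.
    Interleaving is an equivalence relation; let the rank of an order be the
    number of its classes minus one, a number below n.  Finitely many
    comparisons force the interleaved copies to stay interleaved with the same
    offsets, so among the orders of at least the same rank they single out the
    given one [shift_order_window].  This makes the space of orders countable
    [countable_isolating] and puts its k-th derivative inside the set of orders
    of rank at least k [iter_derivative_rank]; the n-th derivative is empty.

    Conversely, number the copies of Z from 0, let those below m be interleaved
    with offsets N and the other ones be stacked above them.  Interleaving the
    copy m as well, with an offset that tends to infinity, gives orders that
    converge to this one [merge_cone_cvg].  By induction an order with
    m = n - k survives k derivations [iter_derivative_family], and the
    derivative of order n - 1 is not empty. *)

(** * Cantor-Bendixson ranks of spaces of boolean functions *)

Section CantorBendixsonCriterion.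
Local Open Scope classical_set_scope.
Variable G : choiceType.
Implicit Types (f g : {ptws G -> bool}) (X : set {ptws G -> bool}).

Lemma nbhs_agree f (s : seq G) :
  nbhs f [set g : {ptws G -> bool} | {in s, forall x, g x = f x}].
Proof.
elim: s => [|x s IH].
  by apply: filterS filterT => g _ x; rewrite in_nil.
have Hx : nbhs f [set g : {ptws G -> bool} | g x = f x].
  have := @proj_continuous G (fun=> bool) x f [set f x] (discrete_set1 _).
  by [].
apply: filterS (filterI Hx IH) => g [/= gx gs] y.
by rewrite in_cons => /orP[/eqP->|/gs].
Qed.

Lemma cvg_ptws (u : nat -> {ptws G -> bool}) f :
  (forall x, exists N, forall l, (N <= l)%N -> u l x = f x) ->
  u @ \oo --> f.
Proof.
move=> uf; apply/cvg_sup => x.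
move=> A [B [[C oC <-] /= Cfx] CA].
have [N HN] := uf x; exists N => // l /= Nl; apply: CA => /=.
by rewrite (HN l Nl).
Qed.

Lemma iter_derivativeS k X :
  iter_derivative k.+1 X `<=` iter_derivative k X.
Proof. by move=> f []. Qed.

Lemma iter_derivative_le j k X :
  (j <= k)%N -> iter_derivative k X `<=` iter_derivative j X.
Proof.
move=> /subnK <-; elim: (k - j)%N => [//|i IH] f.
by rewrite addSn => /iter_derivativeS/IH.
Qed.

Lemma derivative_limit X (u : nat -> {ptws G -> bool}) f :
  X f -> u @ \oo --> f -> (forall l, X (u l) /\ u l <> f) -> derivative X f.
Proof.
move=> Xf uf Xu; split=> // -[_ [V Vf VX]].
have [N _ /(_ N (leqnn N)) /= VN] := uf _ Vf.
have [XN NE] := Xu N; apply: NE.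
by have : (V `&` X) (u N) by []; rewrite VX.
Qed.

(** The function [r] bounds the number of derivations that a point survives:
    some finite set of values of [f] isolates [f] among the points of rank at
    least [r f]. *)
Section Criterion.
Variables (X : set {ptws G -> bool}) (r : {ptws G -> bool} -> nat).
Hypothesis r_isolated : forall f, X f -> exists s : seq G, forall g, X g ->
  {in s, forall x, g x = f x} -> (r f <= r g)%N -> g = f.

Lemma iter_derivative_rank k f :
  iter_derivative k X f -> X f /\ (k <= r f)%N.
Proof.
elim: k f => [f //|k IH] f [kf niso]; have [Xf kr] := IH _ kf.
split=> //; rewrite ltn_neqAle kr andbT; apply/eqP => kE; apply: niso.
split; first exact/mem_set.
have [s Hs] := r_isolated Xf.
exists [set g : {ptws G -> bool} | {in s, forall x, g x = f x}].
  exact: nbhs_agree.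
apply/seteqP; split=> [g [/= gs kg]|_ ->]; last by split.
by have [Xg rg] := IH _ kg; apply: Hs => //; rewrite -kE.
Qed.

(** A point of [Y k.+1] is a limit of points of [Y k], which survive [k]
    derivations by induction, hence also all the smaller numbers of derivations
    that have to be climbed one by one. *)
Lemma iter_derivative_family (Y : nat -> set {ptws G -> bool}) n :
  (forall k, (k < n)%N -> Y k `<=` X) ->
  (forall k f, (k.+1 < n)%N -> Y k.+1 f ->
    exists2 u : nat -> {ptws G -> bool}, u @ \oo --> f &
      forall l, Y k (u l) /\ u l <> f) ->
  forall k, (k < n)%N -> Y k `<=` iter_derivative k X.
Proof.
move=> YX Ylim; elim=> [|k IH] kn f Ykf; first exact: (YX 0%N).
have [u uf uY] := Ylim _ _ kn Ykf.
suff H j : (j <= k.+1)%N -> iter_derivative j X f by exact: H.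
elim: j => [_|j IHj jk]; first exact: (YX _ kn).
apply: (@derivative_limit _ u); [exact: IHj (ltnW jk)| exact: uf|].
move=> l; have [Yul ?] := uY l; split=> //.
have := IH (ltnW kn) _ Yul; exact: iter_derivative_le.
Qed.

(** The derivatives of order at least [n] are empty by the rank bound. If two
    consecutive derivatives agreed earlier, all later ones would agree with
    them, although the one of order [n.-1] meets [Y]. *)
Lemma has_CB_rank_criterion (Y : nat -> set {ptws G -> bool}) n :
  (forall f, X f -> (r f < n)%N) ->
  (forall k, (k < n)%N -> Y k `<=` X) ->
  (forall k f, (k.+1 < n)%N -> Y k.+1 f ->
    exists2 u : nat -> {ptws G -> bool}, u @ \oo --> f &
      forall l, Y k (u l) /\ u l <> f) ->
  (0 < n)%N -> Y n.-1 !=set0 ->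
  has_CB_rank X n.
Proof.
move=> rn YX Ylim n0 [f Yf].
have fX : iter_derivative n.-1 X f.
  by apply: (iter_derivative_family YX Ylim) Yf; rewrite prednK.
have empty k : (n <= k)%N -> iter_derivative k X = set0.
  move=> nk; apply/seteqP; split=> // g /iter_derivative_rank[/rn rg kr].
  by have := leq_ltn_trans (leq_trans nk kr) rg; rewrite ltnn.
split=> [|k kn E]; first by rewrite !empty.
have Ek i : iter_derivative (i + k) X = iter_derivative k X.
  elim: i => [//|i IHi]; rewrite E addSn.
  by rewrite /iter_derivative !iterS -/(iter_derivative _ _) IHi.
have kf : iter_derivative k X f.
  by move: fX; apply: iter_derivative_le; rewrite -ltnS prednK.
by move: kf; rewrite -(Ek (n - k)%N) subnK ?empty // ltnW.
Qed.

(** The rank of [f] together with the list of values that isolates [f] is a code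
    for [f]: of two points with the same code, each isolates the other. *)
Lemma countable_isolating : countable [set: G] -> countable X.
Proof.
move=> cG.
have [h hinj] : exists h : G -> nat, injective h.
  have /countable_injP[h hinj] := cG; exists h => x y.
  by apply: hinj; exact/mem_set.
pose F f : nat * seq (nat * bool) := if pselect (X f) is left Xf then
  (r f, [seq (h x, f x) | x <- sval (cid (r_isolated Xf))]) else (0%N, [::]).
apply/countable_injP; exists (choice.pickle \o F) => f g /set_mem Xf /set_mem Xg /=.
move=> /(pcan_inj choice.pickleK); rewrite /F.
case: pselect => // Xf'; case: pselect => // Xg' [rE].
case: cid => /= s Hs; case: cid => /= t _ st; apply/esym/Hs => //; last first.
  by rewrite rE.
move=> x xs; have : (h x, f x) \in [seq (h x, f x) | x <- s].
  by apply/mapP; exists x.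
by rewrite st => /mapP[y _ [/hinj <- ->]].
Qed.
End Criterion.
End CantorBendixsonCriterion.

(** * Shift-invariant linear orders on n copies of the integers *)

Local Open Scope ring_scope.

Section ShiftOrders.
Variable n : nat.
Implicit Types (Q : 'I_n -> 'I_n -> int -> bool) (j : 'I_n) (c : int).

(** [Q j j' c] means that the point [c] of the copy [j'] lies strictly below the
    point [0] of the copy [j]; by invariance these comparisons determine the
    whole linear order. *)
Record shift_order Q : Prop := ShiftOrder {
  shift_order_irr : forall j, Q j j 0 = false;
  shift_order_total : forall j j' c, (j != j') || (c != 0) -> Q j j' c || Q j' j (- c);
  shift_order_trans : forall j j' j'' c c',
    Q j j' c -> Q j' j'' c' -> Q j j'' (c + c') }.

(** Equivalently, the copy [j'] does not lie entirely above the copy [j]. *)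
Definition reaches Q j j' := (j == j') || `[< exists c, Q j j' c >].
Definition interleaved Q j j' := reaches Q j j' && reaches Q j' j.
Definition leads Q j := [forall i : 'I_n, (i < j)%N ==> ~~ interleaved Q i j].
(** Each class of interleaved copies has exactly one leader, its smallest index,
    and the copy [0] is always a leader: this counts the classes minus one. *)
Definition block_rank Q := #|[set j : 'I_n | (0 < j)%N & leads Q j]|.

Lemma block_rank_lt Q : (0 < n)%N -> (block_rank Q < n)%N.
Proof.
move=> n0; rewrite -[X in (_ < X)%N]card_ord -cardsT; apply: proper_card.
apply/properP; split; first exact: finset.subsetT.
by exists (Ordinal n0); rewrite !inE.
Qed.

Definition int_monotone (q : int -> bool) :=
  (forall a b, a <= b -> q a -> q b) \/ (forall a b, a <= b -> q b -> q a).

Lemma monotone_step (q : int -> bool) :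
  (forall a, q a -> q (a + 1)) \/ (forall a, q a -> q (a - 1)) -> int_monotone q.
Proof.
have up (p : int -> bool) : (forall a, p a -> p (a + 1)) ->
    forall a b, a <= b -> p a -> p b.
  move=> H a b ab pa; have -> : b = a + `|b - a|%N by lia.
  elim: `|b - a|%N => [|k IH]; first by rewrite addr0.
  have -> : a + k.+1 = a + k + 1 by lia.
  exact: H.
case=> H; [left; exact: up | right=> a b ab qb].
have := @up (fun x => q (- x)) _ (- b) (- a); rewrite !opprK; apply=> //; last lia.
by move=> x qx; rewrite opprD; exact: H.
Qed.

(** A monotone predicate that changes its value inside a window is constant on
    each side of it. *)
Lemma monotone_window (q q' : int -> bool) (C : nat) c0 c1 :
  int_monotone q -> int_monotone q' -> q c0 -> ~~ q c1 ->
  `|c0| <= C%:Z -> `|c1| <= C%:Z -> (forall c, `|c| <= C%:Z -> q' c = q c) -> q' =1 q.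
Proof.
move=> mq mq' q0 q1 C0 C1 E c.
have q0' : q' c0 by rewrite E.
have q1' : ~~ q' c1 by rewrite E.
have [cC|cC] := leP `|c| C; first exact: E.
have side p : int_monotone p -> p c0 -> ~~ p c1 -> p c = ((c1 < c0) == (0 < c)).
  have c01 : p c0 -> ~~ p c1 -> c0 <> c1 by move=> p0 p1 e; rewrite e (negPf p1) in p0.
  move=> [up|down] p0 p1; have := c01 p0 p1 => c0c1.
    have c10 : c1 < c0.
      by rewrite ltNge; apply: contra p1 => /up; apply.
    rewrite c10 /=; case: (ltP 0 c) => c0' /=; first by apply: (up c0) => //; lia.
    by apply/negP => pc; case/negP: p1; apply: (up c) => //; lia.
  have c10 : c0 < c1 by rewrite ltNge; apply: contra p1 => /down; apply.
  rewrite ltNge (ltW c10) /=; case: (ltP 0 c) => c0' /=.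
    by apply/negP => pc; case/negP: p1; apply: (down _ c) => //; lia.
  by apply: (down _ c0) => //; lia.
by rewrite (side q mq q0 q1) (side q' mq' q0' q1').
Qed.

Section Order.
Variables (Q : 'I_n -> 'I_n -> int -> bool) (hQ : shift_order Q).

Lemma shift_order_asym j j' c : Q j j' c -> Q j' j (- c) = false.
Proof.
move=> q; apply/negP => /(shift_order_trans hQ q).
by rewrite subrr (shift_order_irr hQ).
Qed.

Lemma shift_order_neg j j' c : (j != j') || (c != 0) -> Q j j' c = ~~ Q j' j (- c).
Proof.
move=> /(shift_order_total hQ).
case: (boolP (Q j j' c)) => [/shift_order_asym->//|_ /=].
by move->.
Qed.

(** The copy [j'] is either increasing or decreasing as a whole, by comparing its
    points [0] and [1]. *)
Lemma shift_order_monotone j j' : int_monotone (Q j j').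
Proof.
apply: monotone_step; have /orP[|] := @shift_order_total _ hQ j' j' 1 (orbT _) => h.
  by left=> a /(shift_order_trans hQ)/(_ h).
by right=> a /(shift_order_trans hQ)/(_ h).
Qed.

Lemma reaches_trans : transitive (reaches Q).
Proof.
move=> j' j j''; rewrite /reaches => /orP[/eqP->//|/asboolP[c q]].
case/orP=> [/eqP<-|/asboolP[c' q']]; apply/orP; right; apply/asboolP.
  by exists c.
by exists (c + c'); exact: shift_order_trans q q'.
Qed.

Lemma interleaved_refl j : interleaved Q j j.
Proof. by rewrite /interleaved /reaches eqxx. Qed.

Lemma interleaved_sym j j' : interleaved Q j j' = interleaved Q j' j.
Proof. by rewrite /interleaved andbC. Qed.

Lemma interleaved_trans : transitive (interleaved Q).
Proof.
move=> j' j j'' /andP[a b] /andP[c d]; rewrite /interleaved.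
by rewrite (reaches_trans a c) (reaches_trans d b).
Qed.

Lemma leads_ex j : exists2 i, leads Q i & interleaved Q i j.
Proof.
case: (@arg_minnP _ j (fun i => interleaved Q i j) (fun i : 'I_n => val i)
  (interleaved_refl j)) => i ij imin.
exists i => //; apply/forallP => k; apply/implyP; rewrite ltnNge.
by apply: contra => ki; apply: imin => /=; exact: interleaved_trans ki ij.
Qed.

Lemma leads_inj i j : leads Q i -> leads Q j -> interleaved Q i j -> i = j.
Proof.
move=> /forallP li /forallP lj ij; apply/val_inj/eqP.
rewrite eqn_leq leqNgt [X in _ && X]leqNgt; apply/andP; split.
  by apply/negP => h; have := li j; rewrite h interleaved_sym ij.
by apply/negP => h; have := lj i; rewrite h ij.
Qed.

Lemma interleaved_witness j j' : interleaved Q j j' ->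
  (exists c, Q j j' c) /\ (exists c, ~~ Q j j' c).
Proof.
have [<- _|jj'] := eqVneq j j'.
  split; last by exists 0; rewrite shift_order_irr.
  by have /orP[] := @shift_order_total _ hQ j j 1 (orbT _); eexists; eassumption.
rewrite /interleaved /reaches [j' == j]eq_sym (negPf jj') /=.
case/andP=> /asboolP h /asboolP[c q]; split=> //; exists (- c).
by rewrite shift_order_asym.
Qed.

(** Failure of [reaches] settles all the comparisons between two copies, hence
    a single bit suffices for copies that are not interleaved. *)
Lemma not_reaches j j' : ~~ reaches Q j j' ->
  (forall c, Q j j' c = false) /\ (forall c, Q j' j c).
Proof.
rewrite /reaches negb_or => /andP[jj' /asboolP nq].
have Q0 c : Q j j' c = false by apply/negP => q; apply: nq; exists c.
by split=> // c; rewrite shift_order_neg 1?eq_sym ?jj' // Q0.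
Qed.

Lemma interleaved_window : exists C : nat, forall j j', interleaved Q j j' ->
  (exists2 c, `|c| <= C%:Z & Q j j' c) /\ (exists2 c, `|c| <= C%:Z & ~~ Q j j' c).
Proof.
have H (x : 'I_n * 'I_n) : exists C : nat, interleaved Q x.1 x.2 ->
  (exists2 c, `|c| <= C%:Z & Q x.1 x.2 c) /\ (exists2 c, `|c| <= C%:Z & ~~ Q x.1 x.2 c).
  have [/interleaved_witness[[c q] [c' q']]|] := boolP (interleaved Q x.1 x.2).
    exists (`|c| + `|c'|)%N => _.
    by split; [exists c | exists c'] => //; lia.
  by exists 0%N.
have [C HC] := choice H; exists (\max_x C x)%N => j j' /(HC (j, j')) /=.
move=> [[c cC q] [c' cC' q']].
have le : (C (j, j'))%:Z <= (\max_x C x)%N%:Z.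
  by rewrite lez_nat; exact: (leq_bigmax (F := C) (j, j')).
by split; [exists c | exists c'] => //; exact: le_trans le.
Qed.
End Order.

(** The window contains witnesses that interleaved copies are interleaved, so the
    classes of [Q'] are unions of classes of [Q]; equality of the numbers of
    classes then makes the classes equal. Inside a class the window shows a
    change of value and monotonicity gives the rest; between classes one
    comparison gives the rest. *)
Lemma shift_order_window Q : shift_order Q -> exists C : nat,
  forall Q', shift_order Q' ->
    (forall j j' c, `|c| <= C%:Z -> Q' j j' c = Q j j' c) ->
    (block_rank Q <= block_rank Q')%N -> forall j j' c, Q' j j' c = Q j j' c.
Proof.
move=> hQ; have [C HC] := interleaved_window hQ; exists C => Q' hQ' E rQ.
have sub j j' : interleaved Q j j' -> interleaved Q' j j'.
  have sub1 i i' : interleaved Q i i' -> reaches Q' i i'.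
    move=> /HC[[c cC q] _]; apply/orP; right; apply/asboolP.
    by exists c; rewrite E.
  by move=> h; rewrite /interleaved !sub1 // interleaved_sym.
have leadsE j : leads Q' j = leads Q j.
  have sub1 i : leads Q' i -> leads Q i.
    move=> /forallP h; apply/forallP => k; apply/implyP => ki.
    by move: (h k); rewrite ki; exact/contra/sub.
  have sE : [set j : 'I_n | (0 < j)%N & leads Q' j] =
            [set j : 'I_n | (0 < j)%N & leads Q j].
    apply/eqP; rewrite eqEcard rQ andbT; apply/fintype.subsetP => i.
    by rewrite !inE => /andP[-> /sub1].
  have [j0|j0] := posnP j.
    by apply/forallP/forallP => _ i; rewrite j0.
  by move/setP/(_ j): sE; rewrite !inE j0.
have intE j j' : interleaved Q' j j' = interleaved Q j j'.
  apply/idP/idP; last exact: sub.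
  have [i li ij] := leads_ex hQ j; have [i' li' ij'] := leads_ex hQ j' => jj'.
  have ii' : i = i'.
    apply: (@leads_inj Q'); rewrite ?leadsE //.
    apply: (interleaved_trans hQ' (sub _ _ ij)).
    apply: (interleaved_trans hQ' jj').
    by rewrite interleaved_sym; exact: sub.
  apply: (interleaved_trans hQ (y := i)); first by rewrite interleaved_sym.
  by rewrite ii'.
move=> j j' c; have [jj'|njj'] := boolP (interleaved Q j j').
  have [[c0 c0C q0] [c1 c1C q1]] := HC _ _ jj'.
  by apply: (monotone_window (shift_order_monotone hQ j j')
    (shift_order_monotone hQ' j j')
    q0 q1 c0C c1C) => x xC; exact: E.
have njj'2 := njj'; rewrite -intE in njj'2.
have C0 : `|0 : int| <= C%:Z by [].
move: njj' njj'2; rewrite /interleaved !negb_and.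
case/orP=> /not_reaches-/(_ hQ)[Qf Qt].
  have r' : reaches Q' j' j.
    by apply/orP; right; apply/asboolP; exists 0; rewrite E.
  by rewrite r' orbF => /not_reaches-/(_ hQ')[-> _]; rewrite Qf.
have r' : reaches Q' j j'.
  by apply/orP; right; apply/asboolP; exists 0; rewrite E.
by rewrite r' => /not_reaches-/(_ hQ')[_ ->]; rewrite Qt.
Qed.
End ShiftOrders.

(** * The group *)

Section IntegerIteration.
Variables (T : Type) (f g : T -> T).
Hypotheses (fK : cancel f g) (gK : cancel g f).

Definition ziter (k : int) : T -> T :=
  match k with Posz m => iter m f | Negz m => iter m.+1 g end.

Lemma ziterS k x : ziter (k + 1) x = f (ziter k x).
Proof.
case: k => [m|[|m]].
- have -> : Posz m + 1 = Posz m.+1 :> int by rewrite -addn1 PoszD.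
  exact: erefl.
- by rewrite -[Negz 0 + 1]/(Posz 0) /= gK.
- have -> : Negz m.+1 + 1 = Negz m by lia.
  exact: (esym (gK _)).
Qed.

Lemma ziterP k x : ziter (k - 1) x = g (ziter k x).
Proof. by rewrite -{2}[k](subrK 1) ziterS fK. Qed.

Lemma ziterD k l x : ziter (k + l) x = ziter k (ziter l x).
Proof.
elim/int_rect: k => [|m IH|m IH]; first by rewrite add0r.
  have -> : Posz m.+1 + l = m%:Z + l + 1 by lia.
  by rewrite ziterS IH.
have -> : - Posz m.+1 + l = - m%:Z + l - 1 by lia.
have -> : - Posz m.+1 = - m%:Z - 1 by lia.
by rewrite !ziterP IH.
Qed.
End IntegerIteration.

(** The matrix (1 1; 1 2), known as Arnold's cat map. Both its eigenvalues are
    positive and irrational. *)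
Definition catmap (v : int * int) : int * int := (v.1 + v.2, v.1 + v.2 *+ 2).
Definition catmap_inv (v : int * int) : int * int := (v.1 *+ 2 - v.2, v.2 - v.1).

Lemma catmapK : cancel catmap catmap_inv.
Proof. by case=> x y; rewrite /catmap /catmap_inv /=; congr pair; lia. Qed.

Lemma catmap_invK : cancel catmap_inv catmap.
Proof. by case=> x y; rewrite /catmap /catmap_inv /=; congr pair; lia. Qed.

Definition catmapz := ziter catmap catmap_inv.

Lemma catmapzD k l v : catmapz (k + l) v = catmapz k (catmapz l v).
Proof. exact: (ziterD catmapK catmap_invK). Qed.

Lemma catmapz_add k : {morph catmapz k : v w / v + w}.
Proof.
have H (f : int * int -> int * int) : {morph f : v w / v + w} ->
    forall m, {morph iter m f : v w / v + w}.
  by move=> fD; elim=> [//|m IH] v w; rewrite !iterS IH fD.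
case: k => m; apply: H => -[x y] [x' y'];
  by rewrite /catmap /catmap_inv /=; congr pair => /=; lia.
Qed.

Lemma catmapz_opp k v : catmapz k (- v) = - catmapz k v.
Proof.
have z0 : catmapz k 0 = 0.
  by apply: (addrI (catmapz k 0)); rewrite -catmapz_add !addr0.
by apply: (addIr (catmapz k v)); rewrite -catmapz_add !addNr.
Qed.

Lemma catmapz0 k : catmapz k 0 = 0.
Proof. by apply: (addrI (catmapz k 0)); rewrite -catmapz_add !addr0. Qed.

Lemma catmapz_eq0 k v : catmapz k v = 0 -> v = 0.
Proof. by move/(congr1 (catmapz (- k))); rewrite -catmapzD addNr catmapz0. Qed.

Definition weight23 (v : int * int) : rat := 2%:Q ^ v.1 * 3%:Q ^ v.2.

Lemma weight23_gt0 v : 0 < weight23 v.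
Proof. by rewrite mulr_gt0 // exprz_gt0. Qed.

Lemma weight23D v w : weight23 (v + w) = weight23 v * weight23 w.
Proof. by rewrite /weight23 /= !expfzDr //; ring. Qed.

Lemma weight23_opp v : weight23 (- v) = (weight23 v)^-1.
Proof. by rewrite /weight23 /= -!invr_expz invfM. Qed.

Lemma weight23_Mn v m : weight23 (v *+ m) = weight23 v ^+ m.
Proof.
elim: m => [|m IH]; first by rewrite mulr0n expr0 /weight23 /= mulr1.
by rewrite mulrS exprS weight23D IH.
Qed.

(** Unique factorization for the primes 2 and 3, with exponents in Z. *)
Lemma weight23_inj : injective weight23.
Proof.
have nat_case (a b : nat) : (2%:Q ^+ a = 3%:Q ^+ b) -> a = 0%N /\ b = 0%N.
  rewrite -!natrX => /eqP; rewrite eqr_nat => /eqP e.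
  have a0 : a = 0%N.
    by case: a e => // a /(congr1 odd); rewrite !oddX /= orbT.
  by move: e; rewrite a0 expn0; case: b => // b; rewrite expnS; lia.
have int_case (a b : int) : 2%:Q ^ a = 3%:Q ^ b -> a = 0 /\ b = 0.
  wlog a0 : a b / 0 <= a => [H e|].
    have [a0|a0] := leP 0 a; first exact: H.
    have [||/eqP ea /eqP eb] := H (- a) (- b); first by lia.
      by rewrite -!invr_expz e.
    by move: ea eb; rewrite !oppr_eq0 => /eqP-> /eqP->.
  case: a a0 => // a _; case: b => b e.
    by have [-> ->] := nat_case _ _ e.
  have : 1 <= 2%:Q ^ a by apply: exprn_ege1.
  by rewrite e NegzE -invr_expz leNgt invf_lt1 ?exprn_gt0 // exprn_egt1.
move=> v w e; have e1 : weight23 (v - w) = 1.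
  by rewrite weight23D weight23_opp e divff // gt_eqF ?weight23_gt0.
apply/eqP; rewrite -subr_eq0; apply/eqP.
have [] := @int_case (v - w).1 (- (v - w).2).
  apply: (@mulIf _ (3%:Q ^ (v - w).2)); first by rewrite expfz_neq0.
  by rewrite -expfzDr // addNr -/(weight23 _) e1.
by case: (v - w) => x y /= -> /eqP; rewrite oppr_eq0 => /eqP ->.
Qed.

Section Group.
Variable n : nat.
Definition slot : Type := ('I_n * int)%type.
HB.instance Definition _ := Countable.on slot.

Definition vec : Type := {fsfun slot -> rat with 0}.
HB.instance Definition _ := Countable.on vec.
Definition vcoef (a : vec) (p : slot) : rat := (a : {fsfun slot -> rat with 0}) p.
Definition supp (a : vec) : seq slot :=
  enum_fset (finsupp (a : {fsfun slot -> rat with 0})).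
Definition mkvec (s : seq slot) (h : slot -> rat) : vec :=
  [fsfun p in [fset x in s]%fset => h p].

Lemma mem_supp (a : vec) p : (p \in supp a) = (vcoef a p != 0).
Proof. by rewrite -[LHS]/(p \in finsupp _) mem_finsupp. Qed.

Lemma vecP (a b : vec) : (forall p, vcoef a p = vcoef b p) -> a = b.
Proof. by move=> h; apply/fsfunP. Qed.

Lemma mkvecE s h p : (h p != 0 -> p \in s) -> vcoef (mkvec s h) p = h p.
Proof.
move=> hp; rewrite /mkvec /vcoef fsfunE /= in_fset /=.
by case: (boolP (p \in s)) => // ps; apply/esym/eqP; apply: contraNT ps.
Qed.

Definition vzero : vec := mkvec [::] (fun=> 0).
Definition vopp (a : vec) : vec := mkvec (supp a) (fun p => - vcoef a p).
Definition vadd (a b : vec) : vec :=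
  mkvec (supp a ++ supp b) (fun p => vcoef a p + vcoef b p).
Definition vscale (r : rat) (a : vec) : vec := mkvec (supp a) (fun p => r * vcoef a p).

Lemma vzeroE p : vcoef vzero p = 0.
Proof. by rewrite mkvecE ?eqxx. Qed.
Lemma voppE a p : vcoef (vopp a) p = - vcoef a p.
Proof. by rewrite mkvecE // mem_supp oppr_eq0. Qed.
Lemma vaddE a b p : vcoef (vadd a b) p = vcoef a p + vcoef b p.
Proof.
rewrite mkvecE // mem_cat !mem_supp; apply: contraNT.
by rewrite negb_or !negbK => /andP[/eqP-> /eqP->]; rewrite addr0.
Qed.
Lemma vscaleE r a p : vcoef (vscale r a) p = r * vcoef a p.
Proof. by rewrite mkvecE // mem_supp; apply: contraNN => /eqP ->; rewrite mulr0. Qed.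

Fact vaddA : associative vadd.
Proof. by move=> a b c; apply: vecP => p; rewrite !vaddE addrA. Qed.
Fact vaddC : commutative vadd.
Proof. by move=> a b; apply: vecP => p; rewrite !vaddE addrC. Qed.
Fact vadd0 : left_id vzero vadd.
Proof. by move=> a; apply: vecP => p; rewrite !vaddE vzeroE add0r. Qed.
Fact vaddN : left_inverse vzero vopp vadd.
Proof. by move=> a; apply: vecP => p; rewrite !vaddE voppE vzeroE addNr. Qed.
HB.instance Definition _ := GRing.isZmodule.Build vec vaddA vaddC vadd0 vaddN.

Lemma vcoefD (a b : vec) p : vcoef (a + b) p = vcoef a p + vcoef b p.
Proof. exact: vaddE. Qed.
Lemma vcoefN (a : vec) p : vcoef (- a) p = - vcoef a p.
Proof. exact: voppE. Qed.
Lemma vcoef0 p : vcoef 0 p = 0.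
Proof. exact: vzeroE. Qed.

Fact vscaleA r r' a : vscale r (vscale r' a) = vscale (r * r') a.
Proof. by apply: vecP => p; rewrite !vscaleE mulrA. Qed.
Fact vscale1 : left_id 1 vscale.
Proof. by move=> a; apply: vecP => p; rewrite !vscaleE mul1r. Qed.
Fact vscaleDr : right_distributive vscale +%R.
Proof. by move=> r a b; apply: vecP => p; rewrite vcoefD !vscaleE vcoefD mulrDr. Qed.
Fact vscaleDl a : {morph vscale^~ a : r r' / r + r'}.
Proof. by move=> r r'; apply: vecP => p; rewrite vcoefD !vscaleE mulrDl. Qed.
HB.instance Definition _ := GRing.Zmodule_isLmodule.Build rat vec
  vscaleA vscale1 vscaleDr vscaleDl.

Lemma vcoefZ r (a : vec) p : vcoef (r *: a) p = r * vcoef a p.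
Proof. exact: vscaleE. Qed.

Lemma vcoef_sum (J : Type) (s : seq J) (F : J -> vec) p :
  vcoef (\sum_(i <- s) F i) p = \sum_(i <- s) vcoef (F i) p.
Proof.
elim: s => [|i s IH]; first by rewrite !big_nil vcoef0.
by rewrite !big_cons vcoefD IH.
Qed.

Definition base (p : slot) : vec := mkvec [:: p] (fun q => (q == p)%:R).

Lemma baseE p q : vcoef (base p) q = (q == p)%:R.
Proof. by rewrite mkvecE // inE pnatr_eq0 eqb0 negbK. Qed.

Lemma base_neq0 p : base p != 0.
Proof.
apply/eqP => /(congr1 (vcoef^~ p)); rewrite baseE eqxx vcoef0.
by move/eqP; rewrite oner_eq0.
Qed.

Lemma vec_decomposition (a : vec) : a = \sum_(p <- supp a) vcoef a p *: base p.
Proof.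
apply: vecP => q; rewrite vcoef_sum.
have [qa|qa] := boolP (q \in supp a).
  rewrite (bigD1_seq q) ?fset_uniq //= vcoefZ baseE eqxx mulr1.
  rewrite big1 ?addr0 // => p /negPf pq.
  by rewrite vcoefZ baseE eq_sym pq mulr0.
have := qa; rewrite mem_supp negbK => /eqP ->; rewrite big_seq big1 // => p ps.
rewrite vcoefZ baseE; case: eqP => [qp|_]; last by rewrite mulr0.
by rewrite qp ps in qa.
Qed.

Definition weight (p : slot) (d : int * int) : rat :=
  weight23 (catmapz (- p.2) d) ^+ p.1.+1.

Lemma weight_gt0 p d : 0 < weight p d.
Proof. by rewrite exprn_gt0 // weight23_gt0. Qed.

Lemma weight_neq0 p d : weight p d != 0.
Proof. by rewrite gt_eqF ?weight_gt0. Qed.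

Lemma weightD p d d' : weight p (d + d') = weight p d * weight p d'.
Proof. by rewrite /weight catmapz_add weight23D exprMn. Qed.

Lemma weight_catmapz p d k : weight p (catmapz k d) = weight (p.1, p.2 - k) d.
Proof. by rewrite /weight /= -catmapzD opprB addrC. Qed.

Lemma weight0 p : weight p 0 = 1.
Proof. by rewrite /weight catmapz0 /weight23 /= mulr1 expr1n. Qed.

Lemma weightN p d : weight p (- d) = (weight p d)^-1.
Proof.
apply: (mulfI (weight_neq0 p d)).
by rewrite -weightD subrr weight0 divff // weight_neq0.
Qed.

Lemma weightMn p d k : weight p (d *+ k) = weight p d ^+ k.
Proof.
elim: k => [|k IH]; first by rewrite mulr0n expr0 weight0.
by rewrite mulrS exprS weightD IH.
Qed.

(** No nonzero element of the plane commutes with a basis vector: both primes are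
    used for this, since a single one would have a kernel of rank one. *)
Lemma weight_eq1 p d : weight p d = 1 -> d = 0.
Proof.
move=> /eqP; rewrite /weight pexpr_eq1 ?ltW ?weight23_gt0 //.
have <- : weight23 0 = 1 by rewrite /weight23 /= mulr1.
by move=> /eqP/weight23_inj; exact: catmapz_eq0.
Qed.

(** Equality of the two characters would make a power of the cat map proportional
    to the identity; a nonzero power is not, since it moves the first axis, and
    then the factors [j + 1] have to agree. *)
Lemma weight_separates p q : p != q -> exists d, 1 < weight p d / weight q d.
Proof.
move=> pq; suff [d wd] : exists d, weight p d != weight q d.
  case: (ltgtP (weight p d) (weight q d)) => [h|h|/eqP h]; last by rewrite h in wd.
    exists (- d); rewrite !weightN invrK mulrC.
    by rewrite ltr_pdivlMr ?weight_gt0 // mul1r.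
  by exists d; rewrite ltr_pdivlMr ?weight_gt0 // mul1r.
(* At M^i e, where [i] is [p.2], the weight at [p] is a power of 2. *)
pose e : int * int := (1, 0).
exists (catmapz p.2 e); apply/eqP; rewrite /weight -!catmapzD addNr -!weight23_Mn.
move/weight23_inj; have MnE (v : int * int) m : v *+ m = (v.1 *+ m, v.2 *+ m).
  by case: v => x y; elim: m => [//|m IH]; rewrite !mulrS IH.
rewrite !MnE /= mul0rn => -[e1 e2].
have l0 : p.2 = q.2.
  apply/eqP; rewrite -subr_eq0 addrC; move: e2.
  have up m : 0 < (iter m.+1 catmap e).1 /\ 0 < (iter m.+1 catmap e).2.
    elim: m => [//|m]; rewrite [iter m.+2 _ _]iterS.
    case: (iter m.+1 _ _) => x y [/= x0 y0].
    by rewrite /catmap /catmap_inv /=; split; lia.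
  have down m : 0 < (iter m.+1 catmap_inv e).1 /\ (iter m.+1 catmap_inv e).2 < 0.
    elim: m => [//|m]; rewrite [iter m.+2 _ _]iterS.
    case: (iter m.+1 _ _) => x y [/= x0 y0].
    by rewrite /catmap /catmap_inv /=; split; lia.
  case: (- q.2 + p.2) => [[//|m]|m] /esym/eqP; rewrite mulrn_eq0 /=.
    by have [_ h] := up m; rewrite (gt_eqF h).
  by have [_ h] := down m; rewrite (lt_eqF h).
case/eqP: pq; case: p q l0 e1 {e2} => [j i] [j' i'] /= ->; rewrite addNr /= => h.
by congr pair; apply/val_inj => /=; lia.
Qed.

Definition act (d : int * int) (k : int) (a : vec) : vec :=
  mkvec [seq (p.1, p.2 + k) | p <- supp a]
        (fun p => weight p d * vcoef a (p.1, p.2 - k)).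

Lemma actE d k a p : vcoef (act d k a) p = weight p d * vcoef a (p.1, p.2 - k).
Proof.
rewrite mkvecE // mulf_eq0 negb_or => /andP[_ ap]; apply/mapP.
exists (p.1, p.2 - k); first by rewrite mem_supp.
by case: p {ap} => j i /=; rewrite subrK.
Qed.

Lemma actD d k (a b : vec) : act d k (a + b) = act d k a + act d k b.
Proof. by apply: vecP => p; rewrite vcoefD !actE vcoefD mulrDr. Qed.

Lemma actN d k (a : vec) : act d k (- a) = - act d k a.
Proof. by apply: vecP => p; rewrite vcoefN !actE vcoefN mulrN. Qed.

Lemma actZ d k r (a : vec) : act d k (r *: a) = r *: act d k a.
Proof. by apply: vecP => p; rewrite vcoefZ !actE vcoefZ mulrCA. Qed.

Lemma act_zero d k : act d k 0 = 0.
Proof. by apply: vecP => p; rewrite actE !vcoef0 mulr0. Qed.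

Lemma act_id (a : vec) : act 0 0 a = a.
Proof.
by apply: vecP => -[j i]; rewrite actE weight0 mul1r subr0.
Qed.

Lemma act_comp d k d' k' (a : vec) :
  act (d + catmapz k d') (k + k') a = act d k (act d' k' a).
Proof.
apply: vecP => p; rewrite !actE weightD weight_catmapz mulrA /=.
by congr (_ * vcoef a (_, _)); rewrite opprD addrA.
Qed.

Lemma act_base d k p :
  act d k (base p) = weight (p.1, p.2 + k) d *: base (p.1, p.2 + k).
Proof.
apply: vecP => q; rewrite vcoefZ actE !baseE.
have -> : ((q.1, q.2 - k) == p) = (q == (p.1, p.2 + k)).
  by case: p q => [j i] [j' i']; rewrite !xpair_eqE subr_eq.
by case: eqP => [->|]; rewrite ?mulr0.
Qed.

Definition tower : Type := (vec * (int * int) * int)%type.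
HB.instance Definition _ := Countable.on tower.

Implicit Types g h : tower.
(** The semidirect product law: an element [(a, d, k)] acts on the vectors by
    [act d k] and on the plane by [catmapz k]. *)
Definition tmul g h : tower :=
  (g.1.1 + act g.1.2 g.2 h.1.1, g.1.2 + catmapz g.2 h.1.2, g.2 + h.2).
Definition tone : tower := (0, 0, 0).
Definition tinv g : tower :=
  (- act (- catmapz (- g.2) g.1.2) (- g.2) g.1.1, - catmapz (- g.2) g.1.2, - g.2).

Fact tmulA : associative tmul.
Proof.
move=> [[a d] k] [[a' d'] k'] [[a'' d''] k'']; rewrite /tmul /=.
by rewrite actD -act_comp catmapz_add -catmapzD !addrA.
Qed.
Fact tmul1 : left_id tone tmul.
Proof. by move=> [[a d] k]; rewrite /tmul /= act_id !add0r. Qed.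
Fact tmulr1 : right_id tone tmul.
Proof. by move=> [[a d] k]; rewrite /tmul /= act_zero catmapz0 !addr0. Qed.
Fact tmulV : left_inverse tone tinv tmul.
Proof. by move=> [[a d] k]; rewrite /tmul /= !addNr. Qed.
Fact tmulrV : right_inverse tone tinv tmul.
Proof.
move=> [[a d] k]; rewrite /tmul /= actN -act_comp catmapz_opp -catmapzD subrr.
by rewrite subrr act_id subrr.
Qed.
HB.instance Definition _ := isGroup.Build tower tmulA tmul1 tmulr1 tmulV tmulrV.

Lemma towerM g h : (g * h)%g =
  (g.1.1 + act g.1.2 g.2 h.1.1, g.1.2 + catmapz g.2 h.1.2, g.2 + h.2).
Proof. by []. Qed.

Lemma towerV g : (g^-1)%g =
  (- act (- catmapz (- g.2) g.1.2) (- g.2) g.1.1, - catmapz (- g.2) g.1.2, - g.2).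
Proof. by []. Qed.

Lemma tower1 : (1%g : tower) = (0, 0, 0).
Proof. by []. Qed.

End Group.

(** * Invariant cones on the plane and on the vectors *)

Lemma seq_maximum (T : eqType) (R : rel T) (s : seq T) :
  transitive R -> {in s &, forall x y, x != y -> R x y || R y x} -> s != [::] ->
  exists2 x, x \in s & {in s, forall y, y != x -> R y x}.
Proof.
move=> Rtr; elim: s => [//|x s IH] tot _.
have [->|s0] := eqVneq s [::].
  by exists x; rewrite ?mem_head // => y; rewrite inE => /eqP->; rewrite eqxx.
have [y z ys zs|y ys ymax] := IH _ s0.
  by apply: tot; rewrite inE ?ys ?zs orbT.
have [xy|xy] := eqVneq x y.
  exists y; rewrite ?inE ?ys ?orbT // => z; rewrite inE => /orP[/eqP->|/ymax//].
  by rewrite xy eqxx.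
have /orP[Rxy|Ryx] : R x y || R y x.
  by apply: tot; rewrite ?inE ?eqxx ?ys ?orbT.
  exists y; rewrite ?inE ?ys ?orbT // => z.
  by rewrite inE => /orP[/eqP->|/ymax].
exists x; rewrite ?mem_head // => z; rewrite inE => /orP[/eqP->|zs zx].
  by rewrite eqxx.
have [->//|zy] := eqVneq z y.
by apply: Rtr Ryx; exact: ymax.
Qed.

Section AdditiveCones.
Variable V : zmodType.

Record add_cone (P : V -> bool) : Prop := AddCone {
  add_cone0 : ~~ P 0;
  add_coneD : forall u v, P u -> P v -> P (u + v);
  add_cone_total : forall v, v != 0 -> P v || P (- v) }.

Variable P : V -> bool.
Hypothesis hP : add_cone P.

Lemma add_coneN v : v != 0 -> P (- v) = ~~ P v.
Proof.
move=> v0; have := add_cone_total hP v0.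
case: (boolP (P v)) => [Pv _|_ /= -> //]; apply/negP => /(add_coneD hP Pv).
by rewrite subrr (negPf (add_cone0 hP)).
Qed.

Lemma add_cone_muln v m : P v -> P (v *+ m.+1).
Proof.
move=> Pv; elim: m => [//|m IH]; rewrite mulrS; exact: (add_coneD hP).
Qed.

Lemma add_cone_opp : add_cone (fun v => P (- v)).
Proof.
split=> [|u v Pu Pv|v v0]; first by rewrite oppr0 (add_cone0 hP).
  by rewrite opprD; exact: (add_coneD hP).
by rewrite opprK orbC; exact: (add_cone_total hP).
Qed.
End AdditiveCones.

Section PlaneCones.
Implicit Types (P : int * int -> bool) (v : int * int).

Definition in_quadrant v := ((0 <= v.1) && (0 <= v.2)) || ((v.1 <= 0) && (v.2 <= 0)).

(** Outside the two closed quadrants the coordinates have opposite signs, and as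
    long as this persists the cat map decreases the sum of their absolute
    values. *)
Lemma catmap_quadrant v : exists m : nat, in_quadrant (catmapz m v).
Proof.
move: {2}(`|v.1| + `|v.2|)%N (leqnn (`|v.1| + `|v.2|)) => b.
elim: b v => [|b IH] [x y] /= vb.
  by exists 0%N; rewrite /in_quadrant /=; lia.
have [q|q] := boolP (in_quadrant (x, y)); first by exists 0%N.
have [q'|q'] := boolP (in_quadrant (catmap (x, y))); first by exists 1%N.
have [|m hm] := IH (catmap (x, y)).
  by move: q q'; rewrite /in_quadrant /catmap /=; lia.
by exists m.+1; rewrite /= -iterS iterSr.
Qed.

Definition catmap_invariant P := forall v, P (catmap v) = P v.

Lemma catmapz_invariant P k v : catmap_invariant P -> P (catmapz k v) = P v.
Proof.
move=> hP; have hP' w : P (catmap_inv w) = P w by rewrite -hP catmap_invK.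
by rewrite /catmapz; case: k => m /=; rewrite ?hP'; elim: m => //= m IH;
  rewrite ?hP ?hP' IH.
Qed.

Lemma pairMn (x y : int) m : (x, y) *+ m = (x *+ m, y *+ m).
Proof. by elim: m => [//|m IH]; rewrite !mulrS IH. Qed.

Lemma plane_cone_pos P x y : add_cone P -> P (1, 0) -> P (0, 1) ->
  0 <= x -> 0 <= y -> (x, y) != 0 -> P (x, y).
Proof.
move=> hP P1 P2; case: x => // x _; case: y => // y _ xy0.
have -> : (Posz x, Posz y) = (1, 0) *+ x + (0, 1) *+ y :> (int * int).
  by rewrite !pairMn !mul0rn; congr pair => /=; lia.
case: x xy0 => [|x]; case: y => [|y] // _.
- by rewrite mulr0n add0r; exact: add_cone_muln.
- by rewrite mulr0n addr0; exact: add_cone_muln.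
by apply: (add_coneD hP); exact: add_cone_muln.
Qed.

Lemma plane_cone_quadrant P v : add_cone P -> P (1, 0) = P (0, 1) ->
  in_quadrant v -> v != 0 -> P v = (P (1, 0) == (0 <= v.1) && (0 <= v.2)).
Proof.
move=> hP E; wlog P1 : P hP E / P (1, 0) => [H|].
  have [P1|P1] := boolP (P (1, 0)); first by move: (H P hP E P1); rewrite P1.
  have e1 : (1, 0) != 0 :> (int * int) by [].
  have e2 : (0, 1) != 0 :> (int * int) by [].
  move=> qv v0; have := H _ (add_cone_opp hP) _ _ qv v0.
  rewrite /= (add_coneN hP e1) (add_coneN hP e2) (add_coneN hP v0) -E P1.
  move=> /(_ isT erefl).
  by case: (P v); case: (_ && _).
have P2 : P (0, 1) by rewrite -E.
rewrite P1 [true == _]eq_sym eqb_id; case: v => x y /orP[] /= /andP[x0 y0] xy.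
  by rewrite x0 y0 plane_cone_pos.
have -> : (0 <= x) && (0 <= y) = false.
  apply/negP => /andP[x0' y0']; case/negP: xy; apply/eqP; congr pair; lia.
apply/negbTE; rewrite -(add_coneN hP xy).
apply: plane_cone_pos => //; rewrite ?oppr_ge0 //.
by rewrite -[(- x, - y)]/(- (x, y)) oppr_eq0.
Qed.

(** If the two basis vectors have the same sign then every vector is moved by the
    cat map into a quadrant, where the sign is known. *)
Lemma plane_cone_eq_same P P' : add_cone P -> add_cone P' ->
  catmap_invariant P -> catmap_invariant P' ->
  P (1, 0) = P (0, 1) -> P' (1, 0) = P (1, 0) -> P' (0, 1) = P (0, 1) -> P' =1 P.
Proof.
move=> hP hP' sP sP' E E1 E2 v.
have [->|v0] := eqVneq v 0.
  by rewrite (negPf (add_cone0 hP)) (negPf (add_cone0 hP')).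
have [m qm] := catmap_quadrant v.
rewrite -(catmapz_invariant m v sP) -(catmapz_invariant m v sP').
have w0 : catmapz m v != 0 by apply: contra_neq v0 => /catmapz_eq0.
by rewrite (plane_cone_quadrant hP E qm w0) (plane_cone_quadrant hP' _ qm w0) ?E1 ?E2.
Qed.

(** If the two basis vectors have opposite signs, a quarter turn reduces to the
    case of equal signs, since it conjugates the cat map to its inverse. These
    two cases are the two eigenlines of the cat map. *)
Lemma plane_cone_eq P P' : add_cone P -> add_cone P' ->
  catmap_invariant P -> catmap_invariant P' ->
  P' (1, 0) = P (1, 0) -> P' (0, 1) = P (0, 1) -> P' =1 P.
Proof.
move=> hP hP' sP sP' E1 E2.
have [E|E] := eqVneq (P (1, 0)) (P (0, 1)); first exact: plane_cone_eq_same.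
(* The quarter turn. *)
pose J v : int * int := (- v.2, v.1).
have JD (u v : int * int) : J (u + v) = J u + J v by rewrite /J /= opprD.
have J0 v : (J v == 0) = (v == 0).
  by case: v => x y; rewrite !xpair_eqE /= oppr_eq0 andbC.
have coneJ (Q : int * int -> bool) : add_cone Q -> add_cone (Q \o J).
  move=> hQ; split=> [|u v|v v0] /=; first exact: add_cone0 hQ.
    by rewrite JD; exact: add_coneD.
  by have := add_cone_total hQ (v := J v); rewrite J0 => /(_ v0).
have invJ Q : catmap_invariant Q -> catmap_invariant (Q \o J).
  move=> sQ v /=; rewrite -[LHS]sQ; congr Q.
  by case: v => x y; rewrite /J /catmap /=; congr pair => /=; lia.
have N1 (Q : int * int -> bool) : add_cone Q -> Q (-1, 0) = ~~ Q (1, 0).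
  move=> hQ; have e1 : (1, 0) != 0 :> (int * int) by [].
  exact: (add_coneN hQ e1).
have JE : P' \o J =1 P \o J.
  have JPE : P (0, 1) = P (- 1, 0).
    by rewrite (N1 P hP); move: E; case: (P (1, 0)); case: (P (0, 1)).
  apply: (plane_cone_eq_same (coneJ _ hP) (coneJ _ hP') (invJ _ sP) (invJ _ sP')).
  - exact: JPE.
  - exact: E2.
  by rewrite /J /= (N1 P hP) (N1 P' hP') E1.
move=> v; have -> : v = J (v.2, - v.1) by rewrite /J /= opprK; case: v.
exact: JE.
Qed.
End PlaneCones.

(** Bernoulli's inequality. *)
Lemma power_unbounded (x y : rat) : 1 < y -> exists k : nat, x < y ^+ k.
Proof.
move=> y1; have bern k : 1 + k%:R * (y - 1) <= y ^+ k.
  elim: k => [|k IH]; first by rewrite mul0r addr0 expr0.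
  have k0 : 0 <= k%:R * (y - 1) ^+ 2 :> rat by rewrite mulr_ge0 ?sqr_ge0.
  have y0 : 0 <= y by lra.
  rewrite exprS -[k.+1]addn1 natrD; apply: le_trans (ler_wpM2l y0 IH).
  rewrite -subr_ge0; apply: le_trans k0 _; rewrite le_eqVlt; apply/orP; left.
  by apply/eqP; ring.
have y10 : 0 < y - 1 by lra.
exists (Num.bound (`|x| / (y - 1))); apply: lt_le_trans (bern _).
have := @archi_boundP _ (`|x| / (y - 1)).
rewrite divr_ge0 ?normr_ge0 ?(ltW y10) // => /(_ isT).
by rewrite ltr_pdivrMr // => h; have := ler_norm x; lra.
Qed.

Section VectorCones.
Variable n : nat.
Local Notation vec := (vec n).
Local Notation slot := (slot n).

Record vec_cone (P : vec -> bool) : Prop := VecCone {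
  vec_cone_add :> add_cone P;
  vec_cone_act : forall d k a, P (act d k a) = P a }.

Section Cone.
Variable P : vec -> bool.
Hypothesis hP : vec_cone P.

(** Multiples by positive integers preserve positivity and reflect it, hence so do
    positive rational multiples. *)
Lemma vec_cone_scale r a : 0 < r -> P a -> P (r *: a).
Proof.
move=> r0 Pa; have a0 : a != 0.
  by apply: contraTneq Pa => ->; exact: add_cone0 hP.
apply: contraT; rewrite -(add_coneN hP); last by rewrite scaler_eq0 gt_eqF.
have [N rE] : exists N : nat, r * (`|denq r|%N.-1.+1)%:R = N.+1%:R.
  exists `|numq r|.-1; rewrite !prednK ?absz_gt0 ?denq_neq0 ?numq_eq0 ?gt_eqF //.
  rewrite !natr_absz !ger0_norm ?denq_ge0 ?ltW ?numq_gt0 //.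
  by rewrite -{1}(divq_num_den r) divfK // intr_eq0 denq_neq0.
move/(add_cone_muln hP (`|denq r|.-1)).
rewrite mulNrn -scaler_nat scalerA mulrC rE scaler_nat (add_coneN hP).
  by rewrite (add_cone_muln hP _ Pa).
by rewrite -scaler_nat scaler_eq0 negb_or a0 pnatr_eq0.
Qed.

(** The sign that makes a basis vector positive; the positive multiple is
    [pos_base]. *)
Definition base_sgn p : rat := if P (base p) then 1 else -1.
Definition pos_base p : vec := base_sgn p *: base p.

Lemma base_sgn_neq0 p : base_sgn p != 0.
Proof. by rewrite /base_sgn; case: ifP. Qed.

Lemma pos_baseP p : P (pos_base p).
Proof.
rewrite /pos_base /base_sgn; case: ifP; rewrite ?scale1r // scaleN1r => h.
by rewrite (add_coneN hP) ?base_neq0 // h.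
Qed.

Definition below p q := P (pos_base q - pos_base p).

Lemma below_irr p : below p p = false.
Proof. by rewrite /below subrr; apply/negbTE/(add_cone0 hP). Qed.

Lemma below_trans : transitive below.
Proof.
move=> q p r pq qr; rewrite /below.
by have -> : pos_base r - pos_base p =
    (pos_base r - pos_base q) + (pos_base q - pos_base p);
  [rewrite addrA subrK | exact: (add_coneD hP)].
Qed.

Lemma below_total p q : p != q -> below p q || below q p.
Proof.
move=> pq; rewrite /below -[pos_base p - _]opprB; apply: (add_cone_total hP).
apply/eqP => /(congr1 (fun b : vec => vcoef b p)).
rewrite vcoefD vcoefN !vcoefZ !baseE eqxx vcoef0.
rewrite (negPf pq) mulr0 mulr1 add0r => /eqP.
by rewrite oppr_eq0 (negPf (base_sgn_neq0 p)).
Qed.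

Lemma act0_base d (p : slot) : act d 0 (base p) = weight p d *: base p.
Proof. by rewrite act_base addr0; case: p. Qed.

Lemma act_shift_base k (p : slot) : act 0 k (base p) = base (p.1, p.2 + k).
Proof. by rewrite act_base weight0 scale1r. Qed.

Lemma base_sgn_shift k p : base_sgn (p.1, p.2 + k) = base_sgn p.
Proof. by rewrite /base_sgn -act_shift_base (vec_cone_act hP). Qed.

Lemma below_shift k p q : below (p.1, p.2 + k) (q.1, q.2 + k) = below p q.
Proof.
rewrite /below -[RHS](vec_cone_act hP 0 k) actD actN /pos_base !base_sgn_shift.
by rewrite !actZ !act_shift_base.
Qed.

(** Conjugating [pos_base q - pos_base p] by a multiple of an element that
    separates the two weights, and rescaling, replaces the coefficient [-1] of
    [pos_base p] by an arbitrarily large negative number. *)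
Lemma below_dominates p q r : below p q -> P (pos_base q + r *: pos_base p).
Proof.
move=> pq; have [r0|r0] := leP 0 r.
  have [->|rn0] := eqVneq r 0; first by rewrite scale0r addr0 pos_baseP.
  apply: (add_coneD hP); first exact: pos_baseP.
  by apply: vec_cone_scale (pos_baseP p); rewrite lt_def rn0.
have [d rho1] : exists d, 1 < weight p d / weight q d.
  by apply: weight_separates; apply: contraTneq pq => ->; rewrite below_irr.
set rho := _ / _ in rho1.
have [k rk] := power_unbounded (- r) rho1.
have key : P (pos_base q - rho ^+ k *: pos_base p).
  move: pq; rewrite /below -(vec_cone_act hP (d *+ k) 0) actD actN !actZ !act0_base.
  move/(@vec_cone_scale (weight q d ^+ k)^-1).
  rewrite invr_gt0 exprn_gt0 ?weight_gt0 //.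
  move=> /(_ isT); rewrite scalerBr !scalerA !weightMn.
  have wq : weight q d ^+ k != 0 by rewrite expf_neq0 // weight_neq0.
  have -> : (weight q d ^+ k)^-1 * base_sgn q * weight q d ^+ k = base_sgn q by field.
  have -> : (weight q d ^+ k)^-1 * base_sgn p * weight p d ^+ k = rho ^+ k * base_sgn p.
    by rewrite /rho expr_div_n; field.
  by [].
have -> : pos_base q + r *: pos_base p =
    (pos_base q - rho ^+ k *: pos_base p) + (rho ^+ k + r) *: pos_base p.
  by rewrite scalerDl addrA subrK.
apply: (add_coneD hP key); apply: vec_cone_scale (pos_baseP p); lra.
Qed.

Lemma leading_pos p (s : seq slot) (c : slot -> rat) t :
  0 < t -> {in s, forall q, below q p} ->
  P (t *: pos_base p + \sum_(q <- s) c q *: base q).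
Proof.
elim: s t => [|q s IH] t t0 sp.
  by rewrite big_nil addr0 vec_cone_scale // pos_baseP.
rewrite big_cons; have t2 : 0 < t / 2 by lra.
have qE : c q *: base q = (t / 2) *: ((2 / t * c q * base_sgn q) *: pos_base q).
  rewrite /pos_base !scalerA; congr (_ *: _).
  have s2 : base_sgn q * base_sgn q = 1.
    by rewrite /base_sgn; case: ifP; rewrite ?mulrNN !mulr1.
  have tn : t != 0 by rewrite gt_eqF.
  by rewrite -[LHS]mulr1 -[X in _ * X = _]s2; field.
have -> : t *: pos_base p + (c q *: base q + \sum_(j <- s) c j *: base j) =
    (t / 2) *: (pos_base p + (2 / t * c q * base_sgn q) *: pos_base q) +
    ((t / 2) *: pos_base p + \sum_(j <- s) c j *: base j).
  rewrite [in RHS]scalerDr -qE addrACA -scalerDl.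
  by have -> : t / 2 + t / 2 = t by field.
apply: (add_coneD hP).
  by apply: vec_cone_scale t2 _; apply: below_dominates; rewrite sp ?mem_head.
by apply: IH t2 _ => x xs; apply: sp; rewrite inE xs orbT.
Qed.

(** The sign of a vector is that of its leading term, the one whose basis vector
    dominates all the others. *)
Lemma leading_sign (a : vec) p : vcoef a p != 0 ->
  (forall q, vcoef a q != 0 -> q != p -> below q p) ->
  P a = (0 < vcoef a p * base_sgn p).
Proof.
have pos (b : vec) : (forall q, vcoef b q != 0 -> q != p -> below q p) ->
    0 < vcoef b p * base_sgn p -> P b.
  move=> bp b0; rewrite (vec_decomposition b) (bigD1_seq p) ?fset_uniq //=; last first.
    by rewrite mem_supp; apply: contraTneq b0 => ->; rewrite mul0r ltxx.
  have -> : vcoef b p *: base p = (vcoef b p * base_sgn p) *: pos_base p.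
    rewrite /pos_base scalerA -mulrA /base_sgn.
    by case: ifP; rewrite ?mulrNN !mulr1.
  rewrite -big_filter; apply: leading_pos => // q.
  by rewrite mem_filter mem_supp => /andP[qp bq]; exact: bp.
move=> ap adom; apply/idP/idP => [Pa|]; last exact: pos.
have a0 : a != 0 by apply: contraTneq Pa => ->; exact: add_cone0 hP.
rewrite ltNge; apply/negP => le0; have : P (- a).
  apply: pos => [q|]; first by rewrite vcoefN oppr_eq0; exact: adom.
  by rewrite vcoefN mulNr oppr_gt0 lt_neqAle le0 mulf_neq0 // base_sgn_neq0.
by rewrite (add_coneN hP) // Pa.
Qed.

Lemma leading_ex (a : vec) : a != 0 ->
  exists2 p, vcoef a p != 0 & forall q, vcoef a q != 0 -> q != p -> below q p.
Proof.
move=> a0; have [||p ps pmax] := @seq_maximum _ below (supp a) below_trans.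
- by move=> p q _ _; exact: below_total.
- apply: contra_neq a0 => s0; rewrite (vec_decomposition a) s0; exact: big_nil.
exists p; first by rewrite -mem_supp.
by move=> q; rewrite -mem_supp; exact: pmax.
Qed.
End Cone.

Lemma vec_cone_eq P P' : vec_cone P -> vec_cone P' ->
  (forall p, P' (base p) = P (base p)) ->
  (forall p q, below P' p q = below P p q) -> P' =1 P.
Proof.
move=> hP hP' Eb Eo a; have [->|a0] := eqVneq a 0.
  by rewrite (negPf (add_cone0 hP)) (negPf (add_cone0 hP')).
have [p ap pmax] := leading_ex hP a0.
rewrite (leading_sign hP ap pmax) (leading_sign hP' ap) ?/base_sgn ?Eb //.
by move=> q aq qp; rewrite Eo pmax.
Qed.

End VectorCones.

(** * Bi-invariant cones on the group *)

Section GroupCones.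
Variable G : groupType.
Implicit Types f : G -> bool.

(** Positive cones in boolean form; see [positive_coneP]. *)
Record group_cone f : Prop := GroupCone {
  group_cone1 : ~~ f 1%g;
  group_coneV : forall g, g <> 1%g -> f g^-1%g = ~~ f g;
  group_coneM : forall g h, f g -> f h -> f (g * h)%g;
  group_coneJ : forall g h, f h -> f (g * h * g^-1)%g }.

Lemma positive_coneP f :
  positive_cone [set g : G | f g]%classic <-> group_cone f.
Proof.
split=> [[[/seteqP[_ cov] d1 d2 d3] fM fJ]|[f1 fV fM fJ]].
  have f1 : ~~ f 1%g.
    by apply/negP => f1; move/disj_setPS: d2 => /(_ 1%g); apply.
  split=> // g g1; have [[fg|[h fh hg]]|//] := cov g I.
    rewrite /= in fg; rewrite fg; apply/negP => fgV.
    move/disj_setPS: d1 => /(_ g); apply; split=> //.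
    by exists (g^-1)%g; rewrite ?invgK.
  rewrite /= in fh; rewrite -hg invgK fh; apply/esym/negP => fhV.
  by move/disj_setPS: d1 => /(_ h); apply; split=> //; exists (h^-1)%g; rewrite ?invgK.
split=> //; split.
- apply/seteqP; split=> // g _; have [->|g1] := pselect (g = 1%g); first by right.
  left; have [fg|fg] := boolP (f g); [by left|right].
  by exists (g^-1)%g; rewrite ?invgK //= fV.
- apply/disj_setPS => g [/= fg [h /= fh hg]].
  have h1 : h <> 1%g by move=> h1; rewrite h1 (negPf f1) in fh.
  by move: (fV h h1); rewrite hg fg fh.
- by apply/disj_setPS => g [/= fg g1]; rewrite g1 (negPf f1) in fg.
apply/disj_setPS => g [/= [h fh <-] /eqP]; rewrite invg_eq1 => /eqP h1.
by move: fh; rewrite h1 /= (negPf f1).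
Qed.

Lemma group_cone_inv f : group_cone f -> group_cone (fun g => f g^-1%g).
Proof.
case=> f1 fV fM fJ; split=> [|g g1|g h fg fh|g h fh].
- by rewrite invg1.
- by rewrite !fV // => /eqP; rewrite invg_eq1 => /eqP.
- by rewrite invgM; exact: fM.
by rewrite !invgM invgK mulgA; exact: fJ.
Qed.

(** Conjugate elements have the same sign; the equation between products spares
    the computation of an inverse. *)
Lemma group_cone_conj f g h h' :
  group_cone f -> (g * h)%g = (h' * g)%g -> f h' = f h.
Proof.
move=> hf gh; have E1 : h' = (g * h * g^-1)%g by rewrite gh mulgK.
have E2 : h = (g^-1 * h' * (g^-1)^-1)%g by rewrite invgK -mulgA -gh mulKg.
by apply/idP/idP => [h1|]; [rewrite E2|rewrite E1]; exact: group_coneJ.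
Qed.
End GroupCones.

Section TowerCones.
Variable n : nat.
Local Notation tower := (tower n).
Implicit Types f : tower -> bool.

Definition tvec (a : vec n) : tower := (a, 0, 0).
Definition tplane (d : int * int) : tower := (0, d, 0).
Definition tshift : tower := (0, 0, 1).

(** The action of [d - 1] on the vectors is invertible because no weight of [d]
    equals one. *)
Lemma vec_fixpoint (a : vec n) d : d != 0 -> exists b, b = a + act d 0 b.
Proof.
move=> d0; exists (mkvec (supp a) (fun p => vcoef a p / (1 - weight p d))).
have w1 p : 1 - weight p d != 0.
  by rewrite subr_eq0 eq_sym; apply: contra_neq d0; exact: weight_eq1.
apply: vecP => -[j i]; have Eb p : vcoef (mkvec (supp a)
    (fun p => vcoef a p / (1 - weight p d))) p = vcoef a p / (1 - weight p d).
  by rewrite mkvecE // mem_supp; apply: contraNN => /eqP ->; rewrite mul0r.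
rewrite vcoefD actE subr0 !Eb /=; field; exact: w1.
Qed.

Section Cone.
Variable f : tower -> bool.
Hypothesis hf : group_cone f.

Lemma vec_cone_tower : vec_cone (f \o tvec).
Proof.
split; first split=> [|a b fa fb|a a0] /=.
- exact: group_cone1 hf.
- have -> : tvec (a + b) = (tvec a * tvec b)%g.
    by rewrite towerM /tvec /= act_id !addr0.
  exact: (group_coneM hf).
- have -> : tvec (- a) = (tvec a)^-1%g.
    apply: (mulgI (tvec a)); rewrite mulgV towerM /= act_id subrr.
    by [].

  by rewrite (group_coneV hf) ?orbN // => -[a1]; rewrite a1 eqxx in a0.
move=> d k a /=; apply: (@group_cone_conj _ f (0, d, k)) => //.
by rewrite !towerM /tvec /= act_id catmapz0 !add0r !addr0.
Qed.

Lemma add_cone_plane : add_cone (f \o tplane).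
Proof.
split=> [|a b fa fb|a a0] /=.
- exact: group_cone1 hf.
- have -> : tplane (a + b) = (tplane a * tplane b)%g.
    by rewrite towerM /tplane /= act_zero !addr0.
  exact: (group_coneM hf).
have -> : tplane (- a) = (tplane a)^-1%g.
  by apply: (mulgI (tplane a)); rewrite mulgV towerM /= act_zero subrr !addr0.
by rewrite (group_coneV hf) ?orbN // => -[a1]; rewrite a1 eqxx in a0.
Qed.

Lemma catmap_invariant_plane : catmap_invariant (f \o tplane).
Proof.
move=> d /=; apply: (@group_cone_conj _ f tshift) => //.
by rewrite !towerM /= !act_zero !add0r !addr0.
Qed.

(** [(a, d, 0)] is the conjugate of [(0, d, 0)] by a vector. *)
Lemma cone_plane_level a d : d != 0 -> f (a, d, 0) = f (tplane d).
Proof.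
move=> d0; have [b bE] := vec_fixpoint a d0.
apply: (@group_cone_conj _ f (tvec b)) => //.
by rewrite !towerM /= act_zero ?catmapz0 !add0r !addr0 -bE.
Qed.

(** [(0, c, 1)] is conjugate to the shift by an element of the plane. A vector
    part is absorbed in a positive element of the plane, next to which it is
    negligible, and larger powers of the shift are products of positive
    elements. *)
Lemma cone_shift_pos a d k : f tshift -> 0 < k -> f (a, d, k).
Proof.
move=> fs k0; have fs1 c : f (0, c, 1).
  (* The solution b of b = c + M b, which exists since det (1 - M) = -1. *)
  rewrite (@group_cone_conj _ f (tplane (c.1 - c.2, - c.1)) tshift _ hf) //.
  rewrite !towerM /= !act_zero; congr (_, _, _); rewrite ?addr0 //.
  case: c => x y; rewrite /catmapz /= /catmap /=; congr pair => /=; lia.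
have [c fc c0] : exists2 c, f (tplane c) & c != 0.
  have e0 : (1, 0) != 0 :> (int * int) by [].
  have /orP[] := add_cone_total add_cone_plane e0 => fe; eexists; try exact: fe.
    by [].
  by [].
have step1 : f (a, d, 1).
  have -> : (a, d, 1) = (((a, c, 0) : tower) * ((0%R, (d - c)%R, 1%R) : tower))%g.
    by rewrite towerM /= act_zero addr0 addrC subrK add0r.
  by apply: (group_coneM hf) => //; rewrite cone_plane_level.
case: k k0 => // -[//|k] _; elim: k => [//|k IH].
have -> : (a, d, Posz k.+2) = (((a, d, Posz k.+1) : tower) * tshift)%g.
  rewrite towerM -[tshift.1.1]/(0 : vec n) -[tshift.1.2]/(0 : int * int).
  by rewrite act_zero catmapz0 !addr0 /= -PoszD addn1.
exact: (group_coneM hf).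
Qed.
End Cone.

Lemma cone_shift_level f a d k : group_cone f -> k != 0 ->
  f (a, d, k) = (f tshift == (0 < k)).
Proof.
move=> hf; wlog k0 : a d k / 0 < k => [H|_].
  have [k0|k0] := ltP 0 k; first by move=> kn; rewrite H // k0.
  move=> kn; have Nk0 : 0 < - k by rewrite oppr_gt0 lt_neqAle kn k0.
  have E : f ((a, d, k) : tower)^-1%g = f tshift.
    by rewrite towerV /= H ?Nk0 ?oppr_eq0 // eqb_id.
  rewrite -[f (a, d, k)]negbK -(group_coneV hf); last first.
    by case=> _ _ k1; rewrite k1 in kn.
  by rewrite E; case: (f tshift).
rewrite k0 eqb_id; have [fs|fs] := boolP (f tshift); first exact: cone_shift_pos.
have fsV : f tshift^-1%g by rewrite (group_coneV hf) //; case.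
have := cone_shift_pos (group_cone_inv hf) a d fsV k0.
rewrite (group_coneV hf) => [/negPf//|]; by case=> _ _ k1; rewrite k1 in k0.
Qed.

Definition slot_order (P : vec n -> bool) (j j' : 'I_n) (c : int) :=
  below P (j', c) (j, 0).

Lemma slot_order_shift P : vec_cone P -> shift_order (slot_order P).
Proof.
move=> hP; split=> [j|j j' c jc|j j' j'' c c' q q']; rewrite /slot_order.
- exact: below_irr.
- have E : below P (j, - c) (j', 0) = below P (j, 0) (j', c).
    by rewrite -[RHS](below_shift hP (- c)) /= add0r subrr.
  rewrite E; apply: (below_total hP); rewrite xpair_eqE negb_and eq_sym.
  by case/orP: jc => ->; rewrite ?orbT.
apply: (below_trans hP) q.
by rewrite /slot_order -(below_shift hP c) /= add0r addrC in q'.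
Qed.

Definition cone_rank f := block_rank (slot_order (f \o tvec)).

Lemma below_slot_order P p q : vec_cone P ->
  below P p q = slot_order P q.1 p.1 (p.2 - q.2).
Proof.
move=> hP; rewrite /slot_order -(below_shift hP (- q.2)).
by case: p q => [j i] [j' i'] /=; rewrite subrr.
Qed.

Lemma tower_cone_eq f g : group_cone f -> group_cone g ->
  f tshift = g tshift ->
  f (tplane (1, 0)) = g (tplane (1, 0)) ->
  f (tplane (0, 1)) = g (tplane (0, 1)) ->
  (f \o tvec) =1 (g \o tvec) -> f = g.
Proof.
move=> hf hg Es E1 E2 Ea; apply: funext => -[[a d] k].
have [->|k0] := eqVneq k 0; last first.
  by rewrite (cone_shift_level _ _ hf k0) (cone_shift_level _ _ hg k0) Es.
have [->|d0] := eqVneq d 0; first exact: Ea.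
rewrite (cone_plane_level hf a d0) (cone_plane_level hg a d0).
exact: (plane_cone_eq (add_cone_plane hg) (add_cone_plane hf)
  (catmap_invariant_plane hg) (catmap_invariant_plane hf)).
Qed.

(** The finite list consists of generators for the two upper levels, of one basis
    vector in each copy of Z, whose sign is that of the whole copy, and of
    differences whose signs are the comparisons in the window. *)
Lemma tower_cone_isolated f : group_cone f -> exists s : seq tower,
  forall g, group_cone g -> {in s, forall x, g x = f x} ->
    (cone_rank f <= cone_rank g)%N -> g = f.
Proof.
move=> hf; have hfa := vec_cone_tower hf.
have [C HC] := shift_order_window (slot_order_shift hfa).
pose nb := pos_base (f \o tvec).
pose window := [seq (Posz i - C%:Z) | i <- iota 0 (C + C).+1].
exists ([:: tshift; tplane (1, 0); tplane (0, 1)] ++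
  [seq tvec (base (j, 0)) | j <- enum 'I_n] ++
  [seq tvec (nb (x.1, 0) - nb (x.2, c)) |
     x <- enum {: 'I_n * 'I_n}, c <- window]).
move=> g hg gf rfg; have hga := vec_cone_tower hg.
have Eb p : (g \o tvec) (base p) = (f \o tvec) (base p).
  have -> : base p = act 0 p.2 (base ((p.1, 0) : slot n)).
    by rewrite act_shift_base /= add0r; case: p.
  rewrite (vec_cone_act hga) (vec_cone_act hfa) /=.
  apply: gf; rewrite !mem_cat; apply/orP; right; apply/orP; left.
  by apply/mapP; exists p.1; rewrite ?mem_enum.
have Enb p : pos_base (g \o tvec) p = nb p by rewrite /nb /pos_base /base_sgn Eb.
apply: tower_cone_eq => //; try by apply: gf; rewrite !mem_cat !inE eqxx ?orbT.
apply: vec_cone_eq => // p q; rewrite !below_slot_order //.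
apply: HC => //; first exact: slot_order_shift.
move=> j j' c cC; rewrite /slot_order /below !Enb /=.
apply: gf; rewrite !mem_cat; apply/orP; right; apply/orP; right.
apply/allpairsP; exists ((j, j'), c); split; rewrite ?mem_enum //=.
apply/mapP; exists (absz (c + C%:Z)); first by rewrite mem_iota; lia.
by lia.
Qed.

End TowerCones.

(** * A family of bi-invariant cones *)

Section PlaneOrder.
(** The forward orbit of a vector under the cat map enters the positive quadrant
    exactly when the vector is positive along the expanding eigenline. *)
Definition plane_pos (v : int * int) : bool :=
  (v != 0) && `[< exists m : nat, 0 <= (catmapz m v).1 /\ 0 <= (catmapz m v).2 >].

Lemma catmap_nonneg v (m : nat) : 0 <= v.1 /\ 0 <= v.2 ->
  0 <= (catmapz m v).1 /\ 0 <= (catmapz m v).2.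
Proof.
move=> v0; rewrite -[catmapz m v]/(iter m catmap v); elim: m => [//|m].
rewrite [iter m.+1 _ _]iterS; case: (iter m _ _) => x y [/= x0 y0].
by rewrite /catmap /=; split; lia.
Qed.

Lemma plane_pos_cone : add_cone plane_pos.
Proof.
split=> [|u v|v v0]; first by rewrite /plane_pos eqxx.
- move=> /andP[u0 /asboolP[i hi]] /andP[v0 /asboolP[j hj]].
  have u1 : catmapz (i + j)%N u != 0 by apply: contra_neq u0 => /catmapz_eq0.
  have {}hi : 0 <= (catmapz (i + j)%N u).1 /\ 0 <= (catmapz (i + j)%N u).2.
    by rewrite PoszD addrC catmapzD; exact: catmap_nonneg.
  have {}hj : 0 <= (catmapz (i + j)%N v).1 /\ 0 <= (catmapz (i + j)%N v).2.
    by rewrite PoszD catmapzD; exact: catmap_nonneg.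
  apply/andP; split; last first.
    apply/asboolP; exists (i + j)%N; rewrite catmapz_add /=.
    by case: hi hj => a b [c d]; rewrite !addr_ge0.
  apply: contra_neq u1 => uv0; have := catmapz_add (i + j)%N u v.
  rewrite uv0 catmapz0; move: (catmapz _ u) (catmapz _ v) hi hj => -[x y] [x' y'] /=.
  move=> [x0 y0] [x0' y0'] [e1 e2]; congr pair => /=; lia.
have [m /orP[/andP[q1 q2]|/andP[q1 q2]]] := catmap_quadrant v; apply/orP.
  by left; rewrite /plane_pos v0; apply/asboolP; exists m.
right; rewrite /plane_pos oppr_eq0 v0; apply/asboolP; exists m.
by rewrite catmapz_opp /= !oppr_ge0.
Qed.

Lemma plane_pos_catmap : catmap_invariant plane_pos.
Proof.
move=> v; rewrite /plane_pos -[catmap v]/(catmapz 1 v); congr (_ && _).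
  by congr (~~ _); apply/eqP/eqP => [/catmapz_eq0//|->]; rewrite catmapz0.
apply/asboolP/asboolP => -[m hm].
  by exists (m + 1)%N; rewrite PoszD catmapzD.
by exists m; rewrite -catmapzD addrC catmapzD; exact: (catmap_nonneg 1 hm).
Qed.
End PlaneOrder.

Section LexicographicVectorCone.
Variable n : nat.
Implicit Types (prec : rel (slot n)) (a : vec n).

Record invariant_order prec : Prop := InvariantOrder {
  prec_irr : irreflexive prec;
  prec_trans : transitive prec;
  prec_total : forall p q, p != q -> prec p q || prec q p;
  prec_shift : forall k p q, prec (p.1, p.2 + k) (q.1, q.2 + k) = prec p q }.

(** The order on the vectors in which [e_q] is infinitely larger than [e_p]
    whenever [prec p q], and all the basis vectors are positive. *)
Definition lead_pos prec a : bool := `[< exists2 p, 0 < vcoef a p &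
  forall q, vcoef a q != 0 -> q != p -> prec q p >].

Lemma lead_pos_eq prec prec' a :
  {in supp a &, forall p q, prec p q = prec' p q} ->
  lead_pos prec a = lead_pos prec' a.
Proof.
move=> E; apply: asbool_equiv_eq; split=> -[p ap lp]; exists p => // q aq qp.
  by rewrite -E ?mem_supp ?aq ?gt_eqF // lp.
by rewrite E ?mem_supp ?aq ?gt_eqF // lp.
Qed.

Section Cone.
Variables (prec : rel (slot n)) (hp : invariant_order prec).

Lemma lead_pos_act d k a : lead_pos prec a -> lead_pos prec (act d k a).
Proof.
move=> /asboolP[p ap lp]; apply/asboolP; exists (p.1, p.2 + k).
  by rewrite actE /= addrK mulr_gt0 ?weight_gt0 //; case: p ap {lp}.
move=> q; rewrite actE mulf_eq0 negb_or => /andP[_ aq] qp.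
rewrite -(prec_shift hp (- k)) /= addrK; have -> : (p.1, p.2) = p by case: p {ap lp qp}.
apply: lp aq _; apply: contra_neq qp => <- /=; rewrite subrK; by case: q.
Qed.

Lemma lead_pos_cone : vec_cone (lead_pos prec).
Proof.
have asym p q : prec p q -> prec q p -> False.
  by move=> pq /(prec_trans hp pq); rewrite (prec_irr hp).
have pos_lead a b p q : 0 < vcoef a p ->
    (forall r, vcoef a r != 0 -> r != p -> prec r p) ->
    (forall r, vcoef b r != 0 -> r != q -> prec r q) ->
    prec q p -> lead_pos prec (a + b).
  move=> ap lp lq qp; apply/asboolP; exists p.
    suff /eqP -> : vcoef (a + b) p == vcoef a p by [].
    rewrite vcoefD -subr_eq0 addrC addKr; apply: contraT => /lq h.
    have pq : p != q by apply: contraTneq qp => ->; rewrite (prec_irr hp).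
    by case: (asym _ _ qp (h pq)).
  move=> r; rewrite vcoefD => abr rp.
  have [ar|ar] := eqVneq (vcoef a r) 0; last exact: lp.
  rewrite ar add0r in abr; have [->//|rq] := eqVneq r q.
  exact: (prec_trans hp (lq _ abr rq) qp).
split; first split=> [|a b|a a0].
- by apply/asboolP => -[p]; rewrite vcoef0 ltxx.
- move=> /asboolP[p ap lp] /asboolP[q bq lq].
  have [pq|pq] := eqVneq p q; last first.
    have /orP[h|h] := prec_total hp pq; last exact: (pos_lead _ _ _ _ ap lp lq h).
    by rewrite addrC; exact: (pos_lead _ _ _ _ bq lq lp h).
  apply/asboolP; exists p; first by rewrite vcoefD addr_gt0 // pq.
  move=> r; rewrite vcoefD => abr rp.
  have [ar|ar] := eqVneq (vcoef a r) 0; last exact: lp.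
  by rewrite ar add0r in abr; rewrite pq; apply: lq; rewrite -?pq.
- have [||p ps pmax] := @seq_maximum _ prec (supp a) (prec_trans hp).
  + by move=> p q _ _; exact: (prec_total hp).
  + apply: contra_neq a0 => s0; rewrite (vec_decomposition a) s0; exact: big_nil.
  have pm q : vcoef a q != 0 -> q != p -> prec q p.
    by rewrite -mem_supp; exact: pmax.
  move: ps; rewrite mem_supp => ap; apply/orP.
  case: (ltgtP 0 (vcoef a p)) => [h|h|h]; last by rewrite -h eqxx in ap.
    by left; apply/asboolP; exists p.
  right; apply/asboolP; exists p; first by rewrite vcoefN oppr_gt0.
  by move=> q; rewrite vcoefN oppr_eq0; exact: pm.
move=> d k a; apply/idP/idP; last exact: lead_pos_act.
move=> /(lead_pos_act (- catmapz (- k) d) (- k)); rewrite -act_comp.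
by rewrite addNr addNr act_id.
Qed.

Lemma lead_pos_base p q : p != q -> lead_pos prec (base q - base p) = prec p q.
Proof.
have dir x y : x != y -> prec x y -> lead_pos prec (base y - base x).
  move=> xy h; apply/asboolP; exists y.
    by rewrite vcoefD vcoefN !baseE eqxx eq_sym (negPf xy) subr0 ltr01.
  move=> r; rewrite vcoefD vcoefN !baseE => rxy ry.
  move: rxy; rewrite (negPf ry); have [->//|_] := r =P x.
  by rewrite subr0 eqxx.
move=> pq; apply/idP/idP => [h|]; last exact: dir.
have /orP[//|/dir h'] := prec_total hp pq.
have := add_coneD lead_pos_cone h (h' _); rewrite eq_sym => /(_ pq).
by rewrite addrA subrK subrr (negPf (add_cone0 lead_pos_cone)).
Qed.
End Cone.
End LexicographicVectorCone.

Section TowerOrder.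
Variable n : nat.

Definition lex_cone (P : vec n -> bool) (g : tower n) : bool :=
  (0 < g.2) || (g.2 == 0) &&
    (plane_pos g.1.2 || (g.1.2 == 0) && P g.1.1).

Lemma lex_cone_group_cone P : vec_cone P -> group_cone (lex_cone P).
Proof.
move=> hP; have hD := plane_pos_cone; have sD := plane_pos_catmap.
have P0 := add_cone0 hP; have D0 := add_cone0 hD.
have plane0 d : plane_pos d -> d != 0 by case/andP.
split.
- by rewrite tower1 /lex_cone /= (negPf P0) ?(negPf D0).
- move=> [[a d] k]; rewrite towerV /lex_cone /= oppr_gt0 oppr_eq0.
  case: (ltgtP 0 k) => //= <- g1; rewrite -[catmapz (- 0) d]/d !oppr_eq0.
  have [d0|d0] := eqVneq d 0; last by rewrite !orbF (add_coneN hD).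
  rewrite d0 oppr0 (negPf D0) /= act_id (add_coneN hP) //.
  by apply/eqP => a0; apply: g1; rewrite a0 d0.
- move=> [[a d] k] [[a' d'] k']; rewrite towerM /lex_cone /=.
  case: (ltgtP 0 k) => //= [k0 _|<-].
    by case: (ltgtP 0 k') => //= [k0' _|<-]; rewrite ?addr0 ?k0 // addr_gt0.
  rewrite add0r -[catmapz 0 d']/d'; case: (ltgtP 0 k') => //= _.
  have [->|d0] := eqVneq d 0; rewrite ?(negPf D0) ?orbF /=.
    rewrite add0r act_id; have [->|d0'] := eqVneq d' 0.
      by rewrite (negPf D0) /=; exact: (add_coneD hP).
    by rewrite orbF => _ ->.
  move=> pd; have [->|d0'] := eqVneq d' 0; first by rewrite addr0 pd.
  by rewrite orbF => pd'; rewrite (add_coneD hD).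
move=> g [[a d] k].
have E3 : (g * ((a, d, k) : tower n) * g^-1)%g.2 = k.
  by rewrite !towerM towerV /= addrAC subrr add0r.
have E2 : k = 0 -> (g * ((a, d, k) : tower n) * g^-1)%g.1.2 = catmapz g.2 d.
  move=> ->; rewrite !towerM towerV /= addr0 catmapz_opp -catmapzD subrr.
  by rewrite -[catmapz 0 _]/g.1.2 addrAC subrr add0r.
have E1 : k = 0 -> d = 0 ->
    (g * ((a, d, k) : tower n) * g^-1)%g.1.1 = act g.1.2 g.2 a.
  move=> -> ->; suff -> : (g * ((a, 0, 0) : tower n) * g^-1)%g =
    (act g.1.2 g.2 a, 0, 0) by [].
  apply: (mulIg g); rewrite mulgVK !towerM /= act_id catmapz0 !addr0.
  by rewrite !add0r [X in (X, _, _)]addrC.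
move: (g * _ * _)%g E3 E2 E1 => [[x y] z] /= ->; rewrite /lex_cone /=.
case: (ltgtP 0 k) => //= <- /(_ erefl) -> /(_ erefl).
rewrite catmapz_invariant //; have [->|d0] := eqVneq d 0; last by rewrite !orbF => _ ->.
by rewrite (negPf D0) catmapz0 eqxx /= => /(_ erefl) ->; rewrite (vec_cone_act hP).
Qed.
End TowerOrder.

Section Family.
Variable n : nat.
Local Notation slot := (slot n).
Implicit Types (p q : slot) (N : nat -> int).

(** The copies with index smaller than [m] share the bottom block; each of the
    others is a block of its own, in the order of the indices. *)
Definition block m (j : nat) := if (j < m)%N then 0%N else j.

(** Inside a block the copy [j] is translated by the offset [N j], and the copies
    are ordered by index at equal positions. *)
Definition merge_order m N : rel slot := fun p q =>
  (block m p.1 < block m q.1)%N || (block m p.1 == block m q.1) &&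
    ((p.2 + N p.1 < q.2 + N q.1) ||
     (p.2 + N p.1 == q.2 + N q.1) && (p.1 < q.1)%N).

Lemma merge_order_invariant m N : invariant_order (merge_order m N).
Proof.
split=> [p|q p r|p q pq|k p q]; rewrite /merge_order.
- by rewrite ltnn ltxx ltnn !andbF.
- move: (block m p.1) (block m q.1) (block m r.1) => x y z.
  move: (p.2 + _) (q.2 + _) (r.2 + _) => u v w.
  by move: (p.1 : nat) (q.1 : nat) (r.1 : nat) => i j k; lia.
- have : (p.1 != q.1 :> nat) || (p.2 != q.2).
    move: pq; case: p q => [j i] [j' i']; rewrite xpair_eqE negb_and.
    by rewrite -(inj_eq val_inj).
  have : p.1 = q.1 :> nat -> N p.1 = N q.1 /\ block m p.1 = block m q.1.
    by move=> ->.
  move: (block m p.1) (block m q.1) (N p.1) (N q.1) (p.2) (q.2).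
  move: (p.1 : nat) (q.1 : nat) => i j x y a b u v.
  by have [->|ij] := eqVneq i j; [move=> [|-> ->] // |]; lia.
by rewrite /= ![_ + k + _]addrAC ltrD2r (inj_eq (addIr k)).
Qed.

Definition merge_cone m N : tower n -> bool := lex_cone (lead_pos (merge_order m N)).

Lemma merge_cone_group_cone m N : group_cone (merge_cone m N).
Proof.
exact/lex_cone_group_cone/lead_pos_cone/merge_order_invariant.
Qed.

Definition push m N (l : nat) : nat -> int :=
  fun j => if j == m then l%:Z else N j.

(** On a finite set, adding the copy [m] to the bottom block with a large offset
    has the same effect as keeping it above that block. *)
Lemma merge_order_push m N (s : seq slot) : (0 < m)%N ->
  exists L : nat, forall l, (L <= l)%N -> {in s &, forall p q,
    merge_order m.+1 (push m N l) p q = merge_order m N p q}.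
Proof.
move=> m0.
have [B hB] : exists B : nat, {in s, forall p : slot, `|p.2| + `|N p.1| <= B%:Z}.
  elim: s => [|p s [B hB]]; first by exists 0%N.
  exists (B + absz p.2 + absz (N p.1))%N => q; rewrite inE => /orP[/eqP->|/hB]; lia.
(* Two points of the given set are at most [B + B] apart after translation. *)
exists (B + B).+1 => l hl p q /hB Bp /hB Bq.
rewrite /merge_order /push /block !ltnS.
case: (ltngtP p.1 m) Bp => hp Bp; case: (ltngtP q.1 m) Bq => hq Bq //=;
  rewrite ?hp ?hq; move: Bp Bq; rewrite ?hp ?hq; lia.
Qed.

Lemma merge_cone_cvg m N g : (0 < m)%N -> exists L : nat, forall l, (L <= l)%N ->
  merge_cone m.+1 (push m N l) g = merge_cone m N g.
Proof.
move=> m0; have [L hL] := merge_order_push N (supp g.1.1) m0; exists L => l Ll.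
rewrite /merge_cone /lex_cone; congr (_ || _ && (_ || _ && _)).
by apply: lead_pos_eq; exact: hL.
Qed.

(** In the merged order some point of the copy [0] lies above a point of the copy
    [m]. *)
Lemma merge_cone_push_neq m N l : (0 < m < n)%N ->
  merge_cone m.+1 (push m N l) <> merge_cone m N.
Proof.
case/andP=> m0 mn E; pose p : slot := (Ordinal mn, 0).
pose q : slot := (Ordinal (ltn_trans m0 mn), `|N 0%N| + l%:Z + 1).
have pq : p != q by rewrite xpair_eqE negb_and -(inj_eq val_inj) /= -lt0n m0.
have := congr1 (fun f => f (tvec (base q - base p))) E.
rewrite /merge_cone /lex_cone /=.
rewrite !(lead_pos_base (merge_order_invariant _ _) pq).
rewrite /merge_order /block /push /= !ltnS leqnn m0 ltnn !eqxx.
by rewrite (ltn_eqF m0) (gtn_eqF m0) ltn0 /= !andbF !orbF; lia.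
Qed.
End Family.

(** * Spaces of orders of prescribed rank *)

Lemma group_cone_orderable (G : groupType) (f : G -> bool) :
  group_cone f -> orderable G.
Proof.
case=> f1 fV fM fJ; exists (fun a b => f (a^-1 * b)%g); split.
- by move=> a; rewrite mulVg; exact/negP.
- move=> a b c ab bc; have -> : (a^-1 * c = (a^-1 * b) * (b^-1 * c))%g.
    by rewrite mulgA mulgK.
  exact: fM.
- move=> a b; have [->|ab] := pselect (a = b); first by constructor 2.
  have ab1 : (a^-1 * b)%g <> 1%g.
    by move=> /(congr1 (fun x => a * x)%g); rewrite mulVKg mulg1 => /esym.
  have [fab|fab] := boolP (f (a^-1 * b)%g); first by constructor 1.
  by constructor 3; rewrite -[(b^-1 * a)%g]invgK invgM invgK fV // negbK in fab *.
move=> a b c ab; split; first by rewrite invgM mulgA mulgVK.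
have := fJ (c^-1)%g _ ab; rewrite invgK => fc.
by rewrite invgM -mulgA [(a^-1 * _)%g]mulgA mulgA.
Qed.

Local Close Scope ring_scope.
Local Open Scope classical_set_scope.

Theorem mainTheorem1 (n : nat) (hn : (2 <= n)%N) :
  exists G : groupType,
    [/\ countable [set: G],
        orderable G,
        countable (space_of_orders G)
      & has_CB_rank (space_of_orders G) n].
Proof.
have n0 : (0 < n)%N by exact: ltnW.
pose X : set {ptws tower n -> bool} := space_of_orders (tower n).
pose rank : {ptws tower n -> bool} -> nat := @cone_rank n.
have isoX f : X f -> exists s : seq (tower n), forall g, X g ->
    {in s, forall x, g x = f x} -> (rank f <= rank g)%N -> g = f.
  move=> /positive_coneP/tower_cone_isolated[s hs]; exists s => g.
  by move=> /positive_coneP; exact: hs.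
have merge_coneX m N : X (merge_cone m N).
  by apply/positive_coneP; exact: merge_cone_group_cone.
exists (tower n); split.
- exact: countableP.
- exact: (group_cone_orderable (@merge_cone_group_cone n 0 (fun=> 0%R))).
- exact: (countable_isolating isoX (@countableP (tower n) _)).
pose Y k : set {ptws tower n -> bool} := range (@merge_cone n (n - k)).
apply: (has_CB_rank_criterion isoX (Y := Y)) => //.
- by move=> f _; exact: block_rank_lt.
- by move=> k _ _ [N _ <-]; exact: merge_coneX.
- move=> k _ kn [N _ <-].
  have m0 : (0 < n - k.+1)%N by rewrite subn_gt0.
  have mE : (n - k = (n - k.+1).+1)%N by rewrite subnSK // ltnW.
  exists (fun l => merge_cone (n - k.+1).+1 (push (n - k.+1) N l)).
    by apply: cvg_ptws => g; exact: merge_cone_cvg.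
  move=> l; split; first by exists (push (n - k.+1) N l); rewrite ?mE.
  by apply: merge_cone_push_neq; rewrite m0 ltn_subrL n0.
by exists (merge_cone (n - n.-1) (fun=> 0%R)); exists (fun=> 0%R).
Qed.
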